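(* Let $\omega$ be a root of $T^3+T^2-2T-1$, $K_{49}=\mathbb{Q}(\omega)$, and $\mathcal{O}_{K_{49}}$ its ring of integers. For every integer $k \geq 4$ there exists a positive integer $n$ such that the quadratic form $Q_k = X_1^2+X_2^2+X_3^2+(8k+5)X_4^2$ represents $n$ over $\mathcal{O}_{K_{49}}$ but not over $\mathbb{Z}$ (i.e. $n=Q_k(x)$ for some $x\in\mathcal{O}_{K_{49}}^4$ but for no $x\in\mathbb{Z}^4$). In particular, there exist infinitely many positive definite quadratic forms of rank $4$ over $\mathbb{Z}$, pairwise non-isometric over $\mathbb{Q}$, for each of which there exist a field extension $L/\mathbb{Q}$ of odd degree and an integer $a$ represented by the form over $\mathcal{O}_L$ but not over $\mathbb{Z}$.
   Context: $K_{49}$ is a totally real cyclic cubic field (of discriminant $49$). Two quadratic forms over $\mathbb{Q}$ are isometric over $\mathbb{Q}$ if one is obtained from the other by an invertible linear change of variables with rational coefficients. *)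

(* Defs.v *)
From mathcomp Require Import all_boot all_order all_algebra all_field.
From mathcomp.multinomials Require Export mpoly.

Set Implicit Arguments.
Unset Strict Implicit.
Unset Printing Implicit Defensive.

Import GRing.Theory Num.Theory.
Local Open Scope ring_scope.

(* An n-ary quadratic form over R is a homogeneous polynomial of degree 2 in
   n variables; over int, odd cross-term coefficients are allowed.           *)
Definition quadratic_form (R : comNzRingType) (n : nat) (q : {mpoly R[n]}) :=
  q \is 2.-homog.

Definition positive_definite (n : nat) (q : {mpoly int[n]}) : Prop :=
  forall x : 'I_n -> int, (exists i, x i != 0) -> 0 < q.@[x].

(* Membership in the ring of integers of the number field L. *)
Definition alg_integer (L : fieldExtType rat) (x : L) : Prop :=
  integralOver (intr : int -> L) x.

Definition represents_Z (n : nat) (q : {mpoly int[n]}) (a : int) : Prop :=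
  exists x : 'I_n -> int, q.@[x] = a.

Definition represents_O (L : fieldExtType rat) (n : nat) (q : {mpoly int[n]})
    (a : int) : Prop :=
  exists2 x : 'I_n -> L, forall i, alg_integer (x i)
    & (map_mpoly (intr : int -> L) q).@[x] = a%:~R.

Definition linear_subst (R : comNzRingType) (n : nat) (M : 'M[R]_n)
    (q : {mpoly R[n]}) : {mpoly R[n]} :=
  q \mPo [tuple \sum_(j < n) M i j *: 'X_j | i < n].

Definition isometric_Q (n : nat) (p q : {mpoly int[n]}) : Prop :=
  exists2 M : 'M[rat]_n, M \in unitmx &
    map_mpoly (intr : int -> rat) q
      = linear_subst M (map_mpoly (intr : int -> rat) p).

(* The variables X_1, ..., X_4 are indexed from 0. *)
Definition Qk (k : int) : {mpoly int[4]} :=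
  'X_0 ^+ 2 + 'X_1 ^+ 2 + 'X_2 ^+ 2 + (8 * k + 5) *: 'X_3 ^+ 2.

(* K is the number field K_49 = Q(w), with w a root of T^3 + T^2 - 2 T - 1. *)
Definition is_K49 (K : fieldExtType rat) (w : K) : Prop :=
  root ('X^3 + 'X^2 - 2 *: 'X - 1 : {poly K}) w /\ <<1; w>>%VS = {:K}%VS.

(* Main.v *)
Require Import Defs.
From Stdlib Require Import ZArith Lia.
From mathcomp Require Import all_boot all_order all_algebra all_field.
From mathcomp.multinomials Require Import mpoly.
From mathcomp Require Import ssrZ zify ring.

Set Implicit Arguments.
Unset Strict Implicit.
Unset Printing Implicit Defensive.

(* Write N = 8 k + 5 and n = 4 N - D with 0 < D <= 2 N and D = 24 (mod 32).
   Over Z, an equality n = x^2 + y^2 + z^2 + N t^2 forces t^2 = 0 or 1, but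
   n = 28 (mod 32) and n - N = 7 (mod 8), so neither n nor n - N is a sum of
   three squares.

   Over O_K take t = w and
     (x, y, z) = (2 c - q) w + (2 c + 2 p) w' + 2 c w'',
   where w, w', w'' are the conjugates of w and q, p, c are in Z^3. The equation
   then amounts to
     c.q = p.p   and   8 c.p = N + q.q + 4 p.q - 4 p.p
   with D = 2 N - 4 c.c - |2 p + q|^2 - q.q. Both conditions are linear in c.
   If q is near (Q, 1, 1), p near 2 q and c near 4 q, then N is near 71 Q^2. For
   a given perturbation and given residues modulo 8, which decide the congruence
   on D, the condition D > 0 confines N to an interval around a quadratic
   polynomial in Q, of length proportional to Q. For large Q finitely many such
   intervals cover the whole gap up to the next Q, which is a finite statement
   about affine functions of Q; the small N are checked one by one.

   For the infinite family, N is iterated under N |-> N^2 - N + 1. The values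
   are pairwise coprime and 5 modulo 8, so the ratio of two of them, which is
   the ratio of the determinants of the forms, is never a rational square. *)

(** * Integer vectors q, p, c for N = 5 (mod 8) *)

Section IntegerVectors.
Local Open Scope Z_scope.

Definition dot (x y : Z * Z * Z) : Z :=
  x.1.1 * y.1.1 + x.1.2 * y.1.2 + x.2 * y.2.

Definition defect (N : Z) (q p c : Z * Z * Z) : Z :=
  2 * N - 4 * dot c c - (4 * dot p p + 4 * dot p q + dot q q) - dot q q.

Definition admissible (N : Z) (q p c : Z * Z * Z) : bool :=
  [&& dot c q =? dot p p,
      8 * dot c p =? N + dot q q + 4 * dot p q - 4 * dot p p,
      0 <? defect N q p c & defect N q p c mod 32 =? 24].

(* Parameters of the perturbation: for an integer m, Q = 2 (m + shift) + 1,
   p - 2 q = (2 slant, height + 1, height), and the first coordinate of c - 4 q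
   is 8 slant + bend. *)
Record shape := Shape { shift : Z; slant : Z; bend : Z; height : Z }.

(* Every N = 5 (mod 8) has this form, with A free once m is chosen. *)
Definition base_num (m A : Z) : Z := 8 * A + 71 * (2 * m + 1) ^ 2 + 270.

Section Family.
Variables (s : shape) (m : Z).

Definition fstQ : Z := 2 * (m + shift s) + 1.
Definition vecQ := (fstQ, 1, 1).
Definition edge := (2 * slant s, height s + 1, height s).
Definition vecP := (2 * fstQ + 2 * slant s, height s + 3, height s + 2).
Definition level : Z :=
  4 * dot vecQ edge + dot edge edge - (8 * slant s + bend s) * fstQ.
(** By 2 a^2 + 2 b^2 = (a + b)^2 + (a - b)^2, the last two squares of [excess] split into a part
    free of A, absorbed here, and the square of [skew]. *)
Definition width : Z :=
  2 * (13 * dot vecQ vecQ + 17 * dot vecQ edge + 5 * dot edge edge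
       - (4 * slant s + bend s) ^ 2) - (level - 4 * height s - 2) ^ 2.

Variable A : Z.

(** A recentred from 2 m + 1 to the shifted [fstQ], as [base_numE] makes precise. *)
Definition residual : Z :=
  A - 71 * (shift s * m + shift s * (shift s + 1) / 2).

(* The second coordinate of c - 4 q, as dictated by the equation for c.p; the
   third one then follows from c.q = p.p, level being the sum of the two. *)
Definition sndY : Z :=
  residual - 27 * slant s * fstQ - 10 * slant s ^ 2
  - 5 * height s ^ 2 - 32 * height s
  - 2 * slant s * (8 * slant s + bend s) - height s * level.
Definition vecC :=
  (4 * fstQ + 8 * slant s + bend s, 4 + sndY, 4 + level - sndY).
Definition skew : Z := 2 * sndY - level - 2.

(* One quarter of D, see defectE. *)
Definition excess : Z :=
  13 * dot vecQ vecQ + 17 * dot vecQ edge + 5 * dot edge edge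
  - (4 * slant s + bend s) ^ 2 - (sndY - 2 * height s - 2) ^ 2
  - (level - sndY - 2 * height s) ^ 2.

Lemma base_numE : base_num m A = 8 * residual + 71 * fstQ ^ 2 + 270.
Proof.
have [j tri] : (2 | shift s * (shift s + 1)).
  have [[j ->]|[j ->]] := Z.Even_or_Odd (shift s).
    by exists (j * (2 * j + 1)); ring.
  by exists ((2 * j + 1) * (j + 1)); ring.
rewrite /base_num /residual /fstQ tri Z.div_mul //.
lia.
Qed.

(* As skew is affine in A, excess is positive when A lies in an interval. *)
Lemma excessE : 2 * excess = width - skew ^ 2.
Proof. by rewrite /excess /width /skew; ring. Qed.

Lemma dot_vecC_vecQ : dot vecC vecQ = dot vecP vecP.
Proof. by rewrite /vecC /level /vecP /vecQ /edge /dot; cbn [fst snd]; ring. Qed.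

Lemma dot_vecC_vecP : 8 * dot vecC vecP =
  base_num m A + dot vecQ vecQ + 4 * dot vecP vecQ - 4 * dot vecP vecP.
Proof.
rewrite base_numE /vecC /sndY /level /vecP /vecQ /edge /dot; cbn [fst snd].
ring.
Qed.

Lemma defectE : defect (base_num m A) vecQ vecP vecC = 4 * excess.
Proof.
rewrite /defect base_numE /excess /vecC /sndY /level /vecP /vecQ /edge /dot.
cbn [fst snd].
ring.
Qed.

Lemma excess_admissible :
  0 < excess -> excess mod 8 = 6 -> admissible (base_num m A) vecQ vecP vecC.
Proof.
move=> F_gt0 F6; rewrite /admissible dot_vecC_vecQ dot_vecC_vecP defectE.
apply/and4P; split; [exact: Z.eqb_refl | exact: Z.eqb_refl | |].
  by apply/Z.ltb_lt; lia.
by apply/Z.eqb_eq; rewrite (Z.mul_mod_distr_l _ 8 4) // F6.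
Qed.

End Family.

Lemma skewE s m A : skew s m A = 2 * A + skew s m 0.
Proof. by rewrite /skew /sndY /residual; ring. Qed.

(** The halving in [residual] involves [shift] alone, so for a fixed shape [excess] is an integer
    polynomial in m and A. *)
Lemma excess_mod s m m' A A' :
    m mod 8 = m' mod 8 -> A mod 8 = A' mod 8 ->
  excess s m A mod 8 = excess s m' A' mod 8.
Proof.
move=> eqm8m eqm8A; rewrite -!/(eqm 8 _ _).
have modD : forall a b c d, eqm 8 a b -> eqm 8 c d -> eqm 8 (a + c) (b + d).
  by move=> a b c d ab cd; apply: Zplus_eqm.
have modB : forall a b c d, eqm 8 a b -> eqm 8 c d -> eqm 8 (a - c) (b - d).
  by move=> a b c d ab cd; apply: Zminus_eqm.
have modM : forall a b c d, eqm 8 a b -> eqm 8 c d -> eqm 8 (a * c) (b * d).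
  by move=> a b c d ab cd; apply: Zmult_eqm.
rewrite /excess /sndY /level /residual /edge /vecQ /fstQ /dot; cbn [fst snd].
rewrite !Z.pow_2_r.
by repeat (apply eqm8m || apply eqm8A || apply eqm_refl
  || apply modB || apply modD || apply modM).
Qed.

(** * Covering all large N by windows *)

Definition attainable N := exists q p c, admissible N q p c.

(* The affine function reach of m is a lower bound for 40 sqrt(width), so that
   excess is positive when 80 A is between lower and upper. *)
Record window := Window { form :> shape; rate : Z; offset : Z }.

Definition reach (w : window) (m : Z) : Z := rate w * m + offset w.
Definition lower (w : window) (m : Z) : Z := - reach w m - 40 * skew w m 0.
Definition upper (w : window) (m : Z) : Z := reach w m - 40 * skew w m 0.
Definition margin (w : window) (m : Z) : Z := 1600 * width w m - reach w m ^ 2.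

(** [margin] is quadratic in m, so its Newton expansion at 15 is exact. *)
Lemma margin_quadratic w x : 2 * margin w (15 + x) =
  2 * margin w 15 + 2 * (margin w 16 - margin w 15) * x
  + (margin w 17 - 2 * margin w 16 + margin w 15) * (x * (x - 1)).
Proof.
rewrite /margin /width /reach /level /edge /vecQ /fstQ /dot; cbn [fst snd].
ring.
Qed.

Lemma lower_affine w x :
  lower w (15 + x) = lower w 15 + (lower w 16 - lower w 15) * x.
Proof.
rewrite /lower /skew /sndY /residual /reach /level /edge /vecQ /fstQ /dot.
cbn [fst snd]; ring.
Qed.

Lemma upper_affine w x :
  upper w (15 + x) = upper w 15 + (upper w 16 - upper w 15) * x.
Proof.
rewrite /upper /skew /sndY /residual /reach /level /edge /vecQ /fstQ /dot.
cbn [fst snd]; ring.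
Qed.

(* An affine function of m is encoded by its value at m = 15 and its slope. *)
Definition line_at (l : Z * Z) (x : Z) : Z := l.1 + l.2 * x.
Definition line_le (l l' : Z * Z) : bool := (l.1 <=? l'.1) && (l.2 <=? l'.2).
Definition line_of (f : Z -> Z) : Z * Z := (f 15, f 16 - f 15).

(* By margin_quadratic, this makes margin positive for all m >= 15. *)
Definition sound (w : window) : bool :=
  let d1 := margin w 16 - margin w 15 in
  let d2 := margin w 17 - 2 * margin w 16 + margin w 15 in
  [&& 0 <? margin w 15, 0 <=? d2 & d2 <=? 2 * d1].

(* Invariant: for the given residues of m and A modulo 8, N is attained whenever
   80 A is at most one of the affine bounds in ls. *)
Definition step (m A : Z) (ls : seq (Z * Z)) (w : window) : seq (Z * Z) :=
  if [&& excess w m A mod 8 =? 6, sound w &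
         has (line_le (line_of (lower w))) ls]
  then line_of (upper w) :: ls else ls.

Lemma line_leP l l' x : 0 <= x -> line_le l l' -> line_at l x <= line_at l' x.
Proof.
move=> x_ge0 /andP[/Z.leb_le le1 /Z.leb_le le2]; rewrite /line_at; nia.
Qed.

Lemma sound_margin w x : 0 <= x -> sound w -> 0 < margin w (15 + x).
Proof.
move=> x_ge0 /and3P[/Z.ltb_lt f_gt0 /Z.leb_le d2_ge0 /Z.leb_le d2_le].
(* The expansion regroups as 2 [margin w 15] + (2 d1 - d2) x + d2 x^2. *)
have := margin_quadratic w x.
move: (margin w (15 + x)) d2_ge0 d2_le => f.
set d1 := margin w 16 - _; set d2 := _ + _; clearbody d1 d2 => d2_ge0 d2_le.
nia.
Qed.

Lemma window_attainable w m A :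
    15 <= m -> sound w -> excess w m A mod 8 = 6 ->
  lower w m <= 80 * A <= upper w m -> attainable (base_num m A).
Proof.
move=> m_ge15 w_sound F6 [loA hiA].
exists (vecQ w m), (vecP w m), (vecC w m A).
apply: excess_admissible => //.
have := @sound_margin w (m - 15) _ w_sound; rewrite Zplus_minus => /(_ _).
rewrite /margin; have := excessE w m A; rewrite skewE.
move: loA hiA; rewrite /lower /upper.
move: (reach w m) (width w m) (skew w m 0) (excess w m A) => R W u F.
move=> lo hi eqF /(_ ltac:(lia)) mar.
(* Thus 1600 skew^2 <= R^2 < 1600 width, and [excess] is positive. *)
have : (40 * (2 * A + u)) ^ 2 <= R ^ 2 by nia.
nia.
Qed.

(* 2840 m = 80 (71 m / 2), and - 71 m <= 2 A <= 71 (m + 1) for a suitable m. *)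
Definition covers (ws : seq window) (m A : Z) : bool :=
  has (line_le (2840 * 16, 2840))
    (foldl (step m A) [:: (- 2840 * 15 - 1, - 2840)] ws).

Lemma covers_attainable ws m A :
    15 <= m -> covers ws (m mod 8) (A mod 8) ->
  - 2840 * m <= 80 * A <= 2840 * (m + 1) -> attainable (base_num m A).
Proof.
move=> m_ge15 cov [loA hiA]; move: cov; rewrite /covers.
set ls := [:: _].
have : forall l, l \in ls -> 80 * A <= line_at l (m - 15) ->
    attainable (base_num m A).
  (* Vacuous at the start: the initial bound is - 2840 m - 1, below 80 A. *)
  by move=> l; rewrite inE => /eqP ->; rewrite /line_at; cbn [fst snd]; lia.
have x_ge0 : 0 <= m - 15 by lia.
elim: ws ls => [|w ws IHws] ls lsP; rewrite [foldl _ _ _]/=.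
  case/hasP=> l l_ls /(line_leP x_ge0) le_l.
  apply: lsP l_ls _; apply: Z.le_trans le_l.
  by rewrite /line_at; cbn [fst snd]; lia.
apply: IHws => l; rewrite /step; case: ifP; last by move=> _; apply: lsP.
case/and3P=> F6 w_sound.
case/hasP=> l0 l0_ls /(line_leP x_ge0) le_l0.
rewrite inE => /predU1P[->|]; last exact: lsP.
rewrite {1}/line_at; cbn [line_of fst snd].
rewrite -upper_affine Zplus_minus => hi.
(* Above [lower] the new window applies; below it an earlier bound does. *)
case: (Z.le_gt_cases (lower w m) (80 * A)) => [lo|lo].
  apply: window_attainable w_sound _ _ => //.
  rewrite (@excess_mod _ _ (m mod 8) _ (A mod 8)) ?Z.mod_mod //.
  exact/Z.eqb_eq.
apply: lsP l0_ls _; move: le_l0.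
rewrite {1}/line_at; cbn [line_of fst snd].
by rewrite -lower_affine Zplus_minus; lia.
Qed.

(* Found by computer search. The order matters: each window has to start below a
   bound reached by the preceding ones. *)
Definition windows : seq window := [::
  Window (Shape 1 (-2) 4 (-1)) 251 293;
  Window (Shape 1 (-2) (-1) 0) 398 (-144);
  Window (Shape (-1) 1 (-3) (-3)) 328 (-13);
  Window (Shape (-1) 1 (-2) (-4)) 374 (-154);
  Window (Shape 1 (-2) 3 (-2)) 328 276;
  Window (Shape 1 (-2) 2 (-3)) 374 284;
  Window (Shape (-1) 1 (-3) (-2)) 328 104;
  Window (Shape (-1) 1 (-2) (-2)) 374 67;
  Window (Shape 1 (-2) 3 (-3)) 328 378;
  Window (Shape 0 0 (-4) (-3)) 251 (-5);
  Window (Shape 0 0 (-2) (-5)) 374 (-258);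
  Window (Shape (-1) 1 0 (-2)) 406 85; Window (Shape (-1) 1 0 0) 406 92;
  Window (Shape 1 (-1) (-3) (-5)) 328 (-863);
  Window (Shape (-1) 1 2 (-2)) 374 156;
  Window (Shape (-1) 1 1 (-4)) 398 187; Window (Shape 0 0 4 1) 251 687;
  Window (Shape 0 0 (-2) (-3)) 374 154;
  Window (Shape 1 (-2) 3 (-6)) 328 1051; Window (Shape 0 0 3 1) 328 512;
  Window (Shape 0 0 (-4) (-1)) 251 205;
  Window (Shape 0 0 (-3) (-1)) 328 223; Window (Shape 0 0 2 1) 374 400;
  Window (Shape 0 0 1 (-1)) 398 225; Window (Shape 0 0 2 (-1)) 374 191;
  Window (Shape 0 0 3 (-1)) 328 164; Window (Shape 0 0 0 1) 406 243;
  Window (Shape (-1) 1 3 (-5)) 328 784; Window (Shape 0 0 1 (-5)) 398 364;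
  Window (Shape (-1) 1 4 (-4)) 251 901; Window (Shape 0 0 (-2) 1) 374 26;
  Window (Shape 1 (-1) (-1) (-4)) 398 203;
  Window (Shape 1 (-1) (-2) (-2)) 374 224;
  Window (Shape 0 0 (-3) 1) 328 (-128); Window (Shape 1 (-1) 2 0) 374 418;
  Window (Shape 1 (-1) 0 (-2)) 406 368; Window (Shape 1 (-1) 0 0) 406 375;
  Window (Shape 1 (-1) (-4) 0) 251 (-477);
  Window (Shape 1 (-1) 2 (-2)) 374 340;
  Window (Shape 1 (-1) 3 (-2)) 328 278;
  Window (Shape (-1) 2 (-3) (-2)) 328 62;
  Window (Shape 1 (-1) 4 (-2)) 251 127;
  Window (Shape 1 (-1) (-3) 1) 328 (-321);
  Window (Shape 0 1 (-3) (-4)) 328 65;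
  Window (Shape (-1) 2 (-1) (-2)) 398 218;
  Window (Shape (-1) 2 (-2) (-1)) 374 130;
  Window (Shape (-1) 2 2 1) 374 716].

(* Only needed for m < 15. *)
Definition extra_shapes : seq shape := [::
  Shape 1 (-1) 3 (-4); Shape 2 (-2) 3 0; Shape 1 (-1) 0 (-4);
  Shape 1 (-2) 5 (-4); Shape (-1) 2 1 (-1); Shape (-1) 1 2 (-4);
  Shape 2 (-2) (-1) (-2); Shape 0 0 0 (-3); Shape (-1) 1 0 (-4);
  Shape 0 1 (-3) (-2); Shape 2 (-2) 5 0; Shape 0 0 6 1;
  Shape 1 (-1) (-1) (-2); Shape 1 (-1) 2 (-4); Shape (-1) (-1) (-1) (-1);
  Shape 0 1 (-3) (-3); Shape (-2) 1 (-3) 0; Shape (-3) 2 (-3) (-3);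
  Shape (-1) 1 (-7) 0; Shape 0 0 4 (-5); Shape 0 1 1 (-2);
  Shape 2 (-3) 0 0; Shape (-1) 0 (-1) (-3); Shape 0 0 2 (-3);
  Shape (-3) 2 (-4) (-3); Shape (-2) 3 (-14) (-4); Shape 1 (-2) 1 0;
  Shape (-2) 0 0 (-3); Shape (-1) 1 (-3) 0; Shape 2 (-2) 1 (-2);
  Shape (-2) 1 (-1) (-3); Shape (-1) (-1) 3 2; Shape (-2) 2 (-7) (-4);
  Shape (-1) 2 (-11) (-2)].

Definition interval (a : Z) (n : nat) : seq Z :=
  map (fun i => a + Z.of_nat i) (iota 0 n).

Lemma mem_interval a n x : a <= x < a + Z.of_nat n -> x \in interval a n.
Proof.
move=> xP; apply/mapP; exists (Z.to_nat (x - a)).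
  rewrite mem_iota /=; lia.
lia.
Qed.

Lemma windows_cover :
  all (fun m => all (covers windows m) (interval 0 8)) (interval 0 8).
Proof. by vm_compute. Qed.

(** * Finite checks, and all N >= 37 *)

Definition profile (m : Z) (s : shape) : Z * Z := (skew s m 0, width s m).

(** By [excessE], d is 2 [excess]: 12 modulo 16 means that [excess] is 6 modulo 8. *)
Definition hits (A : Z) (uw : Z * Z) : bool :=
  let d := uw.2 - (2 * A + uw.1) ^ 2 in (0 <? d) && (d mod 16 =? 12).

Definition shapes : seq shape := map form windows ++ extra_shapes.

Lemma hits_attainable m A :
  has (hits A) (map (profile m) shapes) -> attainable (base_num m A).
Proof.
rewrite has_map; elim: shapes => // s ss IHss; rewrite [has _ _]/=.
case/orP=> [/andP[/Z.ltb_lt d_gt0 /Z.eqb_eq d12]|/IHss //].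
exists (vecQ s m), (vecP s m), (vecC s m A).
move: d_gt0 d12; rewrite /profile; cbn [fst snd].
have := excessE s m A; rewrite skewE => <- F_gt0 F12.
apply: excess_admissible; first by lia.
by move: F12; rewrite (Z.mul_mod_distr_l _ 8 2) //; lia.
Qed.

Definition hit_all (m : Z) (As : seq Z) : bool :=
  let uws := map (profile m) shapes in all (fun A => has (hits A) uws) As.

Lemma hit_allP m As A : hit_all m As -> A \in As -> attainable (base_num m A).
Proof. by move=> /allP h /h; apply: hits_attainable. Qed.

(* The interval contains all A with - 71 m <= 2 A <= 71 (m + 1). *)
Lemma small_hits :
  all (fun m => hit_all m (interval (- (71 * m / 2)) (Z.to_nat (71 * m + 37))))
    (interval 0 15).
Proof. by vm_compute. Qed.

(* N < 341; the two exceptions are N = 53 and N = 101. *)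
Lemma smaller_hits : hit_all 0
  [seq A <- interval (-38) 38 | (A != -36) && (A != -30)].
Proof. by vm_compute. Qed.

Lemma attainable53 : attainable 53.
Proof. by exists (1, 1, 1), (1, -1, -1), (4, -1, 0). Qed.

Lemma attainable101 : attainable 101.
Proof. by exists (1, 1, 3), (0, 2, -3), (2, 5, 2). Qed.

Definition coeff (k : Z) : Z := 8 * k + 5.

Lemma attainable_coeff k : 4 <= k -> attainable (coeff k).
Proof.
rewrite /coeff => k_ge4; case: (Z.lt_ge_cases k 42) => [k_lt42|k_ge42].
  have [->|/eqP k6] := eqVneq k 6; first exact: attainable53.
  have [->|/eqP k12] := eqVneq k 12; first exact: attainable101.
  rewrite (_ : 8 * k + 5 = base_num 0 (k - 42)); last by rewrite /base_num; lia.
  apply: (hit_allP smaller_hits).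
  rewrite mem_filter mem_interval ?andbT; last by lia.
  by apply/andP; split; apply/eqP; lia.
(* With A = k - 42 - 71 m (m + 1) / 2, the required bounds on 2 A say 71 m^2 <= 2 (k - 42) <= 71 (m
   + 1)^2. *)
pose m := Z.sqrt (2 * (k - 42) / 71).
have m_ge0 : 0 <= m by exact: Z.sqrt_nonneg.
have [lo hi] : 71 * m ^ 2 <= 2 * (k - 42) < 71 * (m + 1) ^ 2.
  have q_ge0 : 0 <= 2 * (k - 42) / 71 by apply: Z.div_pos; lia.
  have [] := Z.sqrt_spec _ q_ge0; rewrite -/m -!Z.add_1_r.
  have := Z.div_mod (2 * (k - 42)) 71 ltac:(lia).
  have := Z.mod_pos_bound (2 * (k - 42)) 71 ltac:(lia).
  by move: (_ / 71) (_ mod 71) => j r; nia.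
have [T eqT] : exists T, m * (m + 1) = 2 * T.
  have [[j ->]|[j ->]] := Z.Even_or_Odd m.
    by exists (j * (2 * j + 1)); ring.
  by exists ((2 * j + 1) * (j + 1)); ring.
rewrite (_ : 8 * k + 5 = base_num m (k - 42 - 71 * T)); last first.
  by rewrite /base_num; lia.
set A := k - 42 - 71 * T.
have [loA hiA] : - 71 * m <= 2 * A <= 71 * (m + 1) by rewrite /A; lia.
case: (Z.lt_ge_cases m 15) => m15.
  have /allP/(_ m) := small_hits; rewrite mem_interval // => /(_ isT).
  move/hit_allP; apply; apply: mem_interval.
  have := Z.div_mod (71 * m) 2 ltac:(lia).
  have := Z.mod_pos_bound (71 * m) 2 ltac:(lia).
  lia.
apply: (@covers_attainable windows) => //; last by lia.
have /allP/(_ (m mod 8)) := windows_cover.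
have mod8 x : x mod 8 \in interval 0 8.
  exact/mem_interval/Z.mod_pos_bound.
by move=> /(_ (mod8 m))/allP/(_ _ (mod8 A)).
Qed.

End IntegerVectors.

(** * The forms [Qk] and integers missed over Z *)

Import Order.TTheory GRing.Theory Num.Theory.
Local Open Scope ring_scope.

Lemma meval_map_Qk (R : comNzRingType) (x : 'I_4 -> R) k :
  (map_mpoly (intr : int -> R) (Qk k)).@[x] =
  x 0 ^+ 2 + x 1 ^+ 2 + x 2 ^+ 2 + (8 * k + 5)%:~R * x 3 ^+ 2.
Proof.
rewrite /Qk !rmorphD /= map_mpolyZ !rmorphXn /= !map_mpolyX.
by rewrite mevalZ !rmorphXn /= !mevalXU !rmorphD.
Qed.

Lemma mevalQk (x : 'I_4 -> int) k :
  (Qk k).@[x] = x 0 ^+ 2 + x 1 ^+ 2 + x 2 ^+ 2 + (8 * k + 5) * x 3 ^+ 2.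
Proof. rewrite /Qk !mevalD mevalZ !rmorphXn /= !mevalXU; reflexivity. Qed.

Lemma Qk_homog k : quadratic_form (Qk k).
Proof.
rewrite /quadratic_form /Qk.
have X2 (i : 'I_4) : ('X_i ^+ 2 : {mpoly int[4]}) \is 2.-homog.
  by rewrite (dhomogMn 2 (d := 1)) // dhomogX /= mdeg1.
by rewrite !rpredD ?rpredZ ?X2.
Qed.

Lemma Qk_posdef (k : int) : 0 <= k -> positive_definite (Qk k).
Proof.
move=> k_ge0 x [i xi_neq0]; rewrite mevalQk.
have sq j : 0 <= x j ^+ 2 by rewrite sqr_ge0.
have sq3 : x 3 ^+ 2 <= (8 * k + 5) * x 3 ^+ 2.
  by rewrite ler_peMl ?sq //; lia.
suff : 0 < x 0 ^+ 2 + x 1 ^+ 2 + x 2 ^+ 2 + x 3 ^+ 2.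
  by move/lt_le_trans; apply; rewrite lerD2l.
have : 0 < x i ^+ 2 by rewrite lt_neqAle sq eq_sym sqrf_eq0 xi_neq0.
have : i \in [:: 0; 1; 2; 3] by case: i {xi_neq0} => [[|[|[|[|i]]]] ?].
have := (sq 0, sq 1, sq 2, sq 3) => -[[[sq0 sq1] sq2] sq3'].
rewrite !inE => /or4P[] /eqP -> {sq sq3 k_ge0 xi_neq0};
  move: sq0 sq1 sq2 sq3';
  move: (x 0 ^+ 2) (x 1 ^+ 2) (x 2 ^+ 2) (x 3 ^+ 2); lia.
Qed.

Lemma int_parity (x : int) : exists y, x = 2 * y \/ x = 2 * y + 1.
Proof.
exists (x %/ 2)%Z; have := divz_eq x 2.
have := modz_ge0 x (isT : 2 != 0 :> int).
by have := ltz_pmod x (isT : 0 < 2 :> int); lia.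
Qed.

Lemma sqr_mod8 (x : int) :
  exists j, x ^+ 2 = 8 * j \/ x ^+ 2 = 8 * j + 1 \/ x ^+ 2 = 8 * j + 4.
Proof.
have [u [->|->]] := int_parity x; have [v [->|->]] := int_parity u.
- by exists (2 * v ^+ 2); left; ring.
- by exists (2 * v ^+ 2 + 2 * v); right; right; ring.
- by exists (2 * v ^+ 2 + v); right; left; ring.
- by exists (2 * v ^+ 2 + 3 * v + 1); right; left; ring.
Qed.

Lemma three_squares_mod8 (x y z b : int) :
  x ^+ 2 + y ^+ 2 + z ^+ 2 <> 8 * b + 7.
Proof.
by have [i hi] := sqr_mod8 x; have [j hj] := sqr_mod8 y;
  have [l hl] := sqr_mod8 z; lia.
Qed.

(** A sum of three squares divisible by 4 has even terms, as squares are 0 or 1 modulo 4; dividing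
    by 4 leaves 7 modulo 8. *)
Lemma three_squares_mod32 (x y z b : int) :
  x ^+ 2 + y ^+ 2 + z ^+ 2 <> 32 * b + 28.
Proof.
have even_of_sqr (u j : int) : u ^+ 2 = 4 * j -> exists v, u = 2 * v.
  have [v [->|->]] := int_parity u.
  - by exists v.
  - by rewrite (_ : (2 * v + 1) ^+ 2 = 4 * (v ^+ 2 + v) + 1); [lia | ring].
move=> eq28.
have [i hi] := sqr_mod8 x; have [j hj] := sqr_mod8 y; have [l hl] := sqr_mod8 z.
have [x' ex] : exists u, x = 2 * u.
  by case: hi => [|[]] hi; [apply: (even_of_sqr x (2 * i)) | exfalso
    | apply: (even_of_sqr x (2 * i + 1))]; lia.
have [y' ey] : exists u, y = 2 * u.
  by case: hj => [|[]] hj; [apply: (even_of_sqr y (2 * j)) | exfalso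
    | apply: (even_of_sqr y (2 * j + 1))]; lia.
have [z' ez] : exists u, z = 2 * u.
  by case: hl => [|[]] hl; [apply: (even_of_sqr z (2 * l)) | exfalso
    | apply: (even_of_sqr z (2 * l + 1))]; lia.
apply: (@three_squares_mod8 x' y' z' b).
have sqr_double (u : int) : (2 * u) ^+ 2 = 4 * u ^+ 2 by ring.
rewrite ex ey ez !sqr_double in eq28; move: eq28; clear.
by move: (x' ^+ 2) (y' ^+ 2) (z' ^+ 2); lia.
Qed.

Lemma not_represents_Z (k D : int) :
    (exists j, D = 32 * j + 24) -> 0 < D -> D <= 2 * (8 * k + 5) ->
  ~ represents_Z (Qk k) (4 * (8 * k + 5) - D).
Proof.
move=> [j eqD] D_gt0 leD [x]; rewrite mevalQk.
move: (x 0) (x 1) (x 2) (x 3) => a b c t eqx.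
have [t0|[t1|t4]] : t ^+ 2 = 0 \/ t ^+ 2 = 1 \/ 4 <= t ^+ 2.
- have [t_ge2|t_lt2] := lerP 2 t; first by right; right; nia.
  have [t_leN2|t_gtN2] := lerP t (- 2); first by right; right; nia.
  have [->|[->|->]] : t = - 1 \/ t = 0 \/ t = 1 by lia.
  + by right; left.
  + by left.
  + by right; left.
- by apply: (@three_squares_mod32 a b c (k - j - 1)); rewrite t0 in eqx; lia.
- apply: (@three_squares_mod8 a b c (3 * k - 4 * j - 2)).
  by rewrite t1 in eqx; lia.
- have : (8 * k + 5) * 4 <= (8 * k + 5) * t ^+ 2 by rewrite ler_pM2l //; lia.
  have := (sqr_ge0 a, sqr_ge0 b, sqr_ge0 c) => -[[a2 b2] c2]; lia.
Qed.

(** * The cubic field and representations over its integers *)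

Lemma size_cubic (R : comNzRingType) :
  size ('X^3 + 'X^2 - 2 *: 'X - 1 : {poly R}) = 4.
Proof.
rewrite -addrA -addrA size_polyDl size_polyXn //.
apply: leq_ltn_trans (size_polyD _ _) _.
rewrite gtn_max size_polyXn /=; apply: leq_ltn_trans (size_polyD _ _) _.
rewrite !size_polyN size_poly1 gtn_max /= andbT.
by apply: leq_ltn_trans (size_scale_leq _ _) _; rewrite size_polyX.
Qed.

Lemma monic_cubic (R : comNzRingType) :
  ('X^3 + 'X^2 - 2 *: 'X - 1 : {poly R}) \is monic.
Proof.
rewrite monicE lead_coefE size_cubic !(coefB, coefD, coefZ, coefXn) coefX coef1.
by rewrite /= addr0 mulr0 !subr0.
Qed.

Section CubicField.
Variables (K : fieldExtType rat) (w : K).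
Hypothesis w_root : root ('X^3 + 'X^2 - 2 *: 'X - 1 : {poly K}) w.

Lemma w3E : w ^+ 3 = 1 + 2 * w - w ^+ 2.
Proof.
move: w_root; rewrite /root !hornerE => /eqP e.
by apply/eqP; rewrite -subr_eq0 -e; apply/eqP; ring.
Qed.

Lemma alg_integer_int (m : int) : alg_integer (m%:~R : K).
Proof. exact: (integral_id (intr : int -> K)). Qed.

Lemma alg_integer_w : alg_integer w.
Proof.
exists ('X^3 + 'X^2 - 2 *: 'X - 1).
  exact: monic_cubic.
have -> : map_poly (intr : int -> K) ('X^3 + 'X^2 - 2 *: 'X - 1)
    = 'X^3 + 'X^2 - 2 *: 'X - 1.
  by rewrite !(rmorphB, rmorphD) /= !map_polyXn map_polyZ map_polyX rmorph1.
exact: w_root.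
Qed.

(* w ^+ 2 - 2 and 1 - w - w ^+ 2 are the conjugates of w. *)
Definition conj_comb (a b c : int) : K :=
  a%:~R * w + b%:~R * (w ^+ 2 - 2) + c%:~R * (1 - w - w ^+ 2).

Lemma alg_integer_comb a b c : alg_integer (conj_comb a b c).
Proof.
have i_int := alg_integer_int; have i_w : alg_integer w := alg_integer_w.
have i_w2 : alg_integer (w ^+ 2) by exact: integral_mul.
have i_1 : alg_integer (1 : K) := i_int 1.
have i_2 : alg_integer (2 : K) := i_int 2.
have i_w' : alg_integer (w ^+ 2 - 2) := integral_sub i_w2 i_2.
have i_w'' : alg_integer (1 - w - w ^+ 2) :=
  integral_sub (integral_sub i_1 i_w) i_w2.
exact: integral_add (integral_add (integral_mul (i_int a) i_w)
  (integral_mul (i_int b) i_w')) (integral_mul (i_int c) i_w'').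
Qed.

Lemma conj_comb_sqr (a b c : int) : conj_comb a b c ^+ 2 =
  conj_comb (2 * a * b + 2 * b * c - 2 * a ^+ 2 - 2 * b ^+ 2 - c ^+ 2)
            (2 * b * c + 2 * a * c - a ^+ 2 - 2 * b ^+ 2 - 2 * c ^+ 2)
            (2 * a * b + 2 * a * c - 2 * a ^+ 2 - b ^+ 2 - 2 * c ^+ 2).
Proof.
have w4 : w ^+ 4 = - 1 - w + 3 * w ^+ 2.
  by rewrite (exprS w 3) w3E; ring: w3E.
by rewrite /conj_comb; ring: w3E w4.
Qed.

Lemma conj_combD a b c a' b' c' :
  conj_comb a b c + conj_comb a' b' c' = conj_comb (a + a') (b + b') (c + c').
Proof. by rewrite /conj_comb; ring. Qed.

(** From w + w' + w'' = - 1 one gets w^2 = 2 + w' = - 2 w - w' - 2 w''. *)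
Lemma conj_comb_int (n N : int) :
  conj_comb (2 * N - n) (N - n) (2 * N - n) + N%:~R * w ^+ 2 = n%:~R.
Proof. by rewrite /conj_comb; ring. Qed.

Lemma represents_O_Qk (k D q1 q2 q3 p1 p2 p3 c1 c2 c3 : int) :
    c1 * q1 + c2 * q2 + c3 * q3 = p1 ^+ 2 + p2 ^+ 2 + p3 ^+ 2 ->
    8 * (c1 * p1 + c2 * p2 + c3 * p3)
      = 8 * k + 5 + (q1 ^+ 2 + q2 ^+ 2 + q3 ^+ 2)
        + 4 * (p1 * q1 + p2 * q2 + p3 * q3)
        - 4 * (p1 ^+ 2 + p2 ^+ 2 + p3 ^+ 2) ->
    D = 2 * (8 * k + 5) - 4 * (c1 ^+ 2 + c2 ^+ 2 + c3 ^+ 2)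
        - ((2 * p1 + q1) ^+ 2 + (2 * p2 + q2) ^+ 2 + (2 * p3 + q3) ^+ 2)
        - (q1 ^+ 2 + q2 ^+ 2 + q3 ^+ 2) ->
  represents_O K (Qk k) (4 * (8 * k + 5) - D).
Proof.
move=> cq cp eqD.
pose x q p c := conj_comb (2 * c - q) (2 * c + 2 * p) (2 * c).
exists (fun i : 'I_4 => [:: x q1 p1 c1; x q2 p2 c2; x q3 p3 c3; w]`_i).
  case=> [[|[|[|[|i]]]] lti] //=; try exact: alg_integer_comb.
  exact: alg_integer_w.
rewrite meval_map_Qk /= /x !conj_comb_sqr !conj_combD.
rewrite -[RHS](conj_comb_int _ (8 * k + 5)).
have gap :
    4 * (p1 ^+ 2 + p2 ^+ 2 + p3 ^+ 2 - (c1 * q1 + c2 * q2 + c3 * q3)) = 0.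
  by rewrite cq subrr mulr0.
have eqN : 8 * k + 5 = 8 * (c1 * p1 + c2 * p2 + c3 * p3)
    - (q1 ^+ 2 + q2 ^+ 2 + q3 ^+ 2) - 4 * (p1 * q1 + p2 * q2 + p3 * q3)
    + 4 * (p1 ^+ 2 + p2 ^+ 2 + p3 ^+ 2) by rewrite cp; ring.
(* The coordinates on w' and w'' agree identically, the one on w up to [gap]. *)
congr (conj_comb _ _ _ + _); rewrite eqD eqN.
- by rewrite -[LHS]addr0 -gap; ring.
- by ring.
- by ring.
Qed.

End CubicField.

Lemma K49_exists :
  exists (L : fieldExtType rat) (w : L), is_K49 w /\ \dim {:L} = 3.
Proof.
pose p : {poly rat} := 'X^3 + 'X^2 - 2 *: 'X - 1.
have sz_p : size p = 4 by exact: size_cubic.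
have irr_p : irreducible_poly p.
  apply: cubic_irreducible; rewrite ?sz_p // => x; apply/negP=> /eqP.
  rewrite !hornerE => px0.
  have co_x := coprime_num_den x.
  have d_neq0 : (denq x)%:~R != 0 :> rat by rewrite intr_eq0 denq_neq0.
  have : numq x ^+ 3 + numq x ^+ 2 * denq x - 2 * numq x * denq x ^+ 2
      - denq x ^+ 3 = 0.
    apply: (@intr_inj rat); rewrite !(rmorphD, rmorphN, rmorphM, rmorphXn) /=.
    rewrite numqE.
    transitivity ((x ^+ 3 + x ^+ 2 - 2 * x - 1) * (denq x)%:~R ^+ 3).
      by ring.
    by rewrite px0 mul0r.
  move: (numq x) (denq x) co_x => n d.
  (* If one of n and d is odd, so is the left-hand side. *)
  have [a [->|->]] := int_parity n; have [b [->|->]] := int_parity d.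
  - by rewrite !abszM coprimeMl coprimeMr.
  - move=> _; lia.
  - move=> _; lia.
  - move=> _; lia.
have [L dimL [w w_root w_gen]] := irredp_FAdjoin irr_p.
exists L, w; rewrite dimL sz_p; split=> //; split=> //.
move: w_root; rewrite !(rmorphB, rmorphD) /= !map_polyXn map_polyZ map_polyX.
by rewrite rmorph1 rmorph_nat.
Qed.

(** * Isometry over Q and the infinite family *)

Lemma Gram_of_isometry (k k' : int) :
    isometric_Q (Qk k) (Qk k') ->
  exists r : rat, (8 * k' + 5)%:~R = r ^+ 2 * (8 * k + 5)%:~R.
Proof.
case=> M _ eqM.
pose d (c : int) (i : 'I_4) : rat := if i == 3 then (8 * c + 5)%:~R else 1.
have evalQ (c : int) (v : 'I_4 -> rat) :
    (map_mpoly intr (Qk c)).@[v] = \sum_i d c i * v i ^+ 2.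
  rewrite meval_map_Qk !big_ord_recl big_ord0 /d /= !mul1r addr0 !addrA.
  congr (v _ ^+ 2 + v _ ^+ 2 + v _ ^+ 2 + _ * v _ ^+ 2); exact/val_inj.
have eqV (v : 'I_4 -> rat) : \sum_i d k' i * v i ^+ 2
    = \sum_i d k i * (\sum_j M i j * v j) ^+ 2.
  rewrite -!evalQ eqM /linear_subst comp_mpoly_meval; apply: meval_eq => i.
  rewrite tnth_mktuple raddf_sum /=; apply: eq_bigr => j _.
  by rewrite mevalZ mevalXU.
(* [D c] is the Gram matrix of [Qk c], which M transforms by congruence. *)
pose D c := diag_mx (\row_i d c i) : 'M[rat]_4.
have detD c : \det (D c) = (8 * c + 5)%:~R.
  rewrite det_diag (bigD1 3) //= mxE /d eqxx big1 ?mulr1 // => i /negbTE i3.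
  by rewrite mxE i3.
(* Polarization: evaluate on sums of two vectors of the standard basis. *)
suff eqD : D k' = M^T *m D k *m M.
  exists (\det M); rewrite -!detD eqD !det_mulmx det_tr; ring.
pose e (j i : 'I_4) : rat := (i == j)%:R.
have sumMe i j : \sum_l M i l * e j l = M i j.
  rewrite (bigD1 j) //= /e eqxx mulr1 big1 ?addr0 // => l /negbTE ->.
  by rewrite mulr0.
pose B (i j : 'I_4) := \sum_l d k l * (M l i * M l j).
have sqrB i : \sum_l d k l * (\sum_m M l m * e i m) ^+ 2 = B i i.
  by apply: eq_bigr => l _; rewrite sumMe expr2.
have sqrBD i j : \sum_l d k l * (\sum_m M l m * (e i m + e j m)) ^+ 2
    = B i i + B j j + 2 * B i j.
  rewrite /B mulr_sumr -!big_split; apply: eq_bigr => l _ /=.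
  by under eq_bigr do rewrite mulrDr; rewrite big_split /= !sumMe; ring.
have sum_e i c : \sum_l d c l * e i l ^+ 2 = d c i.
  rewrite (bigD1 i) //= /e eqxx expr1n mulr1 big1 ?addr0 // => m /negbTE ->.
  by rewrite expr0n mulr0.
have sum_eD i j : \sum_l d k' l * (e i l + e j l) ^+ 2
    = d k' i + d k' j + 2 * (d k' i * (i == j)%:R).
  have eij : \sum_l d k' l * (e i l * e j l) = d k' i * (i == j)%:R.
    rewrite (bigD1 i) //= {1}/e eqxx mul1r /e big1 ?addr0 // => m /negbTE ->.
    by rewrite mul0r mulr0.
  rewrite -eij -(sum_e i) -(sum_e j) mulr_sumr -!big_split.
  by apply: eq_bigr => l _ /=; ring.
have eqB i j : B i j = d k' i * (i == j)%:R.
  have := eqV (fun m => e i m + e j m); rewrite sum_eD sqrBD.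
  have := eqV (e i); have := eqV (e j); rewrite !sum_e !sqrB => -> ->.
  by move/addrI/(mulfI (isT : 2 != 0 :> rat)).
apply/matrixP=> i j; rewrite mul_mx_diag !mxE -[LHS]mulr_natr -eqB.
by apply: eq_bigr => l _; rewrite !mxE; ring.
Qed.

(* On N = 8 k + 5 this recursion reads N |-> N ^+ 2 - N + 1. *)
Definition seqk (i : nat) : int := iter i (fun k => 8 * k ^+ 2 + 9 * k + 2) 4.

Lemma seqkS i : seqk i.+1 = 8 * seqk i ^+ 2 + 9 * seqk i + 2.
Proof. by []. Qed.

Lemma seqk_ge4 i : 4 <= seqk i.
Proof.
elim: i => // i IHi; rewrite seqkS; have := sqr_ge0 (seqk i).
by move: (seqk i ^+ 2) (seqk i) IHi; lia.
Qed.

(** N_i divides N_(i+1) - 1 = N_i (N_i - 1), hence every later N_j - 1. *)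
Lemma seqk_coprime i j : (i < j)%N ->
  coprimez (8 * seqk i + 5) (8 * seqk j + 5).
Proof.
move=> ltij; have [q eqq] : exists q, 8 * seqk j + 5 = q * (8 * seqk i + 5) + 1.
  rewrite -(subnKC ltij); elim: (j - _)%N => [|m [q IHm]].
    by rewrite addn0 seqkS; exists (8 * seqk i + 4); ring.
  rewrite addnS seqkS; exists ((8 * seqk (i.+1 + m) + 5) * q).
  set N := 8 * seqk (i.+1 + m) + 5 in IHm *.
  by transitivity (N * (N - 1) + 1); [rewrite /N | rewrite {2}IHm]; ring.
by rewrite eqq /coprimez gcdzMDl gcdz1.
Qed.

(** For r = n / d in lowest terms, b d^2 = n^2 a; coprimality makes a and d^2 divide each other. *)
Lemma coprime_sqr_ratio (a b : int) (r : rat) :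
    0 < a -> coprimez a b -> b%:~R = r ^+ 2 * a%:~R ->
  exists s : int, a = s ^+ 2.
Proof.
move=> a_gt0 co_ab eqb; exists (denq r).
have eqZ : b * denq r ^+ 2 = numq r ^+ 2 * a.
  apply: (@intr_inj rat); rewrite !(rmorphM, rmorphXn) /= eqb numqE; ring.
have co : coprimez (denq r ^+ 2) (numq r ^+ 2).
  rewrite coprimezXl // coprimezXr // coprimez_sym.
  exact: coprime_num_den.
have d_a : (denq r ^+ 2 %| a)%Z.
  by rewrite -(Gauss_dvdzr _ co) -eqZ dvdz_mull.
have a_d : (a %| denq r ^+ 2)%Z.
  by rewrite -(Gauss_dvdzr _ co_ab) eqZ dvdz_mull.
have : `|a|%N = `|denq r ^+ 2|%N.
  by apply/eqP; rewrite eqn_dvd; apply/andP; split.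
have : 0 <= denq r ^+ 2 by rewrite sqr_ge0.
by move: (denq r ^+ 2) => s; lia.
Qed.

(** A square is never 5 modulo 8. *)
Lemma not_isometric (k k' : int) :
    0 <= k -> coprimez (8 * k + 5) (8 * k' + 5) ->
  ~ isometric_Q (Qk k) (Qk k').
Proof.
move=> k_ge0 co /Gram_of_isometry[r]; case/coprime_sqr_ratio => // [|s eqs].
  by lia.
by have [j] := sqr_mod8 s; rewrite -eqs; lia.
Qed.

(** * From integer vectors to the two claims *)

Lemma K49_represents (K : fieldExtType rat) (w : K) (k : int) :
    root ('X^3 + 'X^2 - 2 *: 'X - 1 : {poly K}) w -> 4 <= k ->
  exists n : int,
    [/\ 0 < n, represents_O K (Qk k) n & ~ represents_Z (Qk k) n].
Proof.
move=> w_root k_ge4.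
have [] := @attainable_coeff (Z_of_int k) ltac:(lia).
move=> [[q1 q2] q3] [[[p1 p2] p3] [[[c1 c2] c3]]].
(* All entries come from [int], so the identities over [Z] transfer. *)
rewrite -[q1]int_of_ZK -[q2]int_of_ZK -[q3]int_of_ZK -[p1]int_of_ZK
  -[p2]int_of_ZK -[p3]int_of_ZK -[c1]int_of_ZK -[c2]int_of_ZK -[c3]int_of_ZK.
move: {q1 q2 q3 p1 p2 p3 c1 c2 c3} (int_of_Z q1) (int_of_Z q2) (int_of_Z q3)
  (int_of_Z p1) (int_of_Z p2) (int_of_Z p3) (int_of_Z c1) (int_of_Z c2)
  (int_of_Z c3) => q1 q2 q3 p1 p2 p3 c1 c2 c3.
rewrite /admissible /defect /dot /coeff; cbn [fst snd].
case/and4P=> /Z.eqb_eq cq /Z.eqb_eq cp /Z.ltb_lt D_gt0 /Z.eqb_eq D_mod.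
pose D : int := 2 * (8 * k + 5) - 4 * (c1 ^+ 2 + c2 ^+ 2 + c3 ^+ 2)
  - ((2 * p1 + q1) ^+ 2 + (2 * p2 + q2) ^+ 2 + (2 * p3 + q3) ^+ 2)
  - (q1 ^+ 2 + q2 ^+ 2 + q3 ^+ 2).
have cqE : c1 * q1 + c2 * q2 + c3 * q3 = p1 ^+ 2 + p2 ^+ 2 + p3 ^+ 2.
  by move: cq; clear; lia.
have cpE : 8 * (c1 * p1 + c2 * p2 + c3 * p3)
    = 8 * k + 5 + (q1 ^+ 2 + q2 ^+ 2 + q3 ^+ 2)
      + 4 * (p1 * q1 + p2 * q2 + p3 * q3)
      - 4 * (p1 ^+ 2 + p2 ^+ 2 + p3 ^+ 2).
  by move: cp; clear; lia.
move: D_gt0 D_mod; set d := (X in Z.modulo X _); rewrite -!/d.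
have {cq cp d} -> : d = Z_of_int D by rewrite /d /D; clear; lia.
move=> D_gt0 D_mod.
have D_gt0' : 0 < D by move: (D) D_gt0; clear; lia.
have [j eqD] : exists j, D = 32 * j + 24.
  have := Z.div_mod (Z_of_int D) (Zpos 32) ltac:(done); rewrite D_mod.
  move: (Z.div _ _) => t; rewrite -[t]int_of_ZK; clearbody D; clear.
  by exists (int_of_Z t); lia.
(* D is 2 N minus nonnegative terms, so n = 4 N - D >= 2 N. *)
have leD : D <= 2 * (8 * k + 5).
  rewrite /D -!addrA -!opprD gerBl.
  by do ?[exact: sqr_ge0 | apply: addr_ge0 | apply: mulr_ge0].
exists (4 * (8 * k + 5) - D); split.
- by move: D_gt0' leD k_ge4; move: (D); clear; lia.
- exact: (represents_O_Qk w_root cqE cpE).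
- by apply: not_represents_Z => //; exists j.
Qed.

Theorem theorem4p2 :
  (forall (K : fieldExtType rat) (w : K), is_K49 w ->
     forall k : int, 4 <= k ->
       exists n : int,
         [/\ 0 < n, represents_O K (Qk k) n & ~ represents_Z (Qk k) n])
  /\
  (exists F : nat -> {mpoly int[4]},
     [/\ forall i, quadratic_form (F i),
         forall i, positive_definite (F i),
         forall i j, i <> j -> ~ isometric_Q (F i) (F j)
       & forall i, exists (L : fieldExtType rat) (a : int),
           [/\ odd (\dim {:L}), represents_O L (F i) a
             & ~ represents_Z (F i) a]]).
Proof.
split=> [K w [w_root _] k|]; first exact: K49_represents w_root.
have k_ge0 i : 0 <= seqk i by apply: le_trans (seqk_ge4 i).
exists (fun i => Qk (seqk i)); split=> [i|i|i j /eqP|i].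
- exact: Qk_homog.
- exact: Qk_posdef.
- rewrite neq_ltn => /orP[lt_ij|lt_ji]; apply: not_isometric => //.
    exact: seqk_coprime.
  by rewrite coprimez_sym seqk_coprime.
have [L [w [[w_root _] dimL]]] := K49_exists.
have [n [_ rep_n not_rep_n]] := K49_represents w_root (seqk_ge4 i).
by exists L, n; rewrite dimL.
Qed.
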